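(* Let $x:M^n\rightarrow M^{n+1}_1(c)$, $c\in\{0,1,-1\}$, be a spacelike Dupin hypersurface, and let $\phi:M^{n+1}_1(c)\to M^{n+1}_1(c)$ be a conformal transformation. Then $\phi\circ x:M^n\rightarrow M^{n+1}_1(c)$ is a spacelike Dupin hypersurface.
   Context: $\mathbb{R}^{m}_s$ denotes $\mathbb{R}^m$ with $\langle X,Y\rangle_s=-\sum_{i=1}^s x_iy_i+\sum_{j=s+1}^{m}x_jy_j$. The Lorentzian space form $M^{n+1}_1(c)$ is $\mathbb{R}^{n+1}_1$ for $c=0$, $\mathbb{S}^{n+1}_1(1)=\{x\in\mathbb{R}^{n+2}_1:\langle x,x\rangle_1=1\}$ for $c=1$, and $\mathbb{H}^{n+1}_1(-1)=\{x\in\mathbb{R}^{n+2}_2:\langle x,x\rangle_2=-1\}$ for $c=-1$. A spacelike hypersurface is a smooth immersion $x:M^n\to M^{n+1}_1(c)$ of an $n$-manifold whose induced metric is positive definite; its principal curvatures are the eigenvalues of its shape operator with respect to a unit (timelike) normal. A curvature surface of $M^n$ is a smooth connected submanifold $S$ such that for each $p\in S$ the tangent space $T_pS$ equals a principal space (eigenspace of the shape operator) at $p$. The hypersurface is Dupin if along each curvature surface the associated principal curvature is constant. Conformal transformations: let $\mathbb{Q}^{n+1}_1=\{[X]\in\mathbb{R}P^{n+2}:\langle X,X\rangle_2=0\}$, on which the group $O(n+3,2)$ of linear maps of $\mathbb{R}^{n+3}_2$ preserving $\langle,\rangle_2$ acts by $T([X])=[XT]$. Conformal embeddings $\sigma_c:M^{n+1}_1(c)\to\mathbb{Q}^{n+1}_1$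 are $\sigma_0(u)=[(\frac{\langle u,u\rangle_1+1}{2},u,\frac{\langle u,u\rangle_1-1}{2})]$, $\sigma_1(u)=[(1,u)]$, $\sigma_{-1}(u)=[(u,1)]$. A conformal transformation $\phi$ of $M^{n+1}_1(c)$ is a map of the form $\phi=\sigma_c^{-1}\circ T\circ\sigma_c$ with $T\in O(n+3,2)$ (possibly defined only on an open dense subset of $M^{n+1}_1(c)$, in which case $x(M^n)$ is assumed to lie in its domain). *)

(* Defs.v *)
From HB Require Import structures.
From mathcomp Require Import all_boot all_order all_algebra.
From mathcomp Require Import all_classical all_reals all_analysis.

Set Implicit Arguments.
Unset Strict Implicit.
Unset Printing Implicit Defensive.

Import Order.TTheory GRing.Theory Num.Theory.
Import numFieldNormedType.Exports.

Local Open Scope classical_set_scope.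
Local Open Scope ring_scope.

(* Vectors are rows, so a linear map is a matrix acting on the right; in      *)
(* particular [jacobian f u], [eigenspace] and [eigenvalue] of the library    *)
(* all follow the convention v |-> v *m A.                                    *)

(** ** Smooth maps between open subsets of Euclidean spaces *)

Section Smooth.
Context {R : realType} {m k : nat}.
Implicit Types (f : 'rV[R]_m -> 'rV[R]_k) (U : set 'rV[R]_m).

Definition iter_derive (vs : seq 'rV[R]_m) f : 'rV[R]_m -> 'rV[R]_k :=
  foldr (fun v g => 'D_v g) f vs.

(* C^infinity on an open set U; the values of f outside U are irrelevant      *)
(* because U is open.                                                         *)
Definition smooth_on U f : Prop :=
  forall (vs : seq 'rV[R]_m) (u : 'rV[R]_m),
    U u -> differentiable (iter_derive vs f) u.

End Smooth.

(** ** Smooth manifolds *)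

(* [chart_map] only matters on [chart_dom], and [chart_inv] only on the image *)
(* of [chart_dom].                                                            *)
Record chart (R : realType) (n : nat) (T : Type) := Chart {
  chart_dom : set T;
  chart_map : T -> 'rV[R]_n;
  chart_inv : 'rV[R]_n -> T
}.

Section IsChart.
Context {R : realType} {n : nat} {T : topologicalType}.
Implicit Types K L : chart R n T.

Definition is_chart K : Prop :=
  [/\ open (chart_dom K),
      open (chart_map K @` chart_dom K),
      forall p, chart_dom K p -> chart_inv K (chart_map K p) = p,
      {within chart_dom K, continuous (chart_map K)} &
      {within chart_map K @` chart_dom K, continuous (chart_inv K)}].

Definition smooth_transition K L : Prop :=
  smooth_on (chart_map K @` (chart_dom K `&` chart_dom L))
            (chart_map L \o chart_inv K).

End IsChart.

Record manifold (R : realType) (n : nat) := Manifold {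
  mcarrier :> topologicalType;
  mhausdorff : hausdorff_space mcarrier;
  msecond_countable : @second_countable mcarrier;
  atlas : set (chart R n mcarrier);
  atlas_chart : forall K, atlas K -> is_chart K;
  atlas_cover : forall p : mcarrier, exists2 K, atlas K & chart_dom K p;
  atlas_smooth : forall K L, atlas K -> atlas L -> smooth_transition K L
}.

Section SmoothMaps.
Context {R : realType}.

(* Smoothness of a map into R^k on the open subset O of M.                    *)
Definition smooth_vfun {n k : nat} (M : manifold R n) (O : set M)
    (f : M -> 'rV[R]_k) : Prop :=
  forall K, atlas K ->
    smooth_on (chart_map K @` (chart_dom K `&` O)) (f \o chart_inv K).

(* The matrix of the differential of f at p, the tangent space at p being     *)
(* identified with R^n by means of the chart K.                               *)
Definition differential {n k : nat} {M : manifold R n} (K : chart R n M)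
    (f : M -> 'rV[R]_k) (p : M) : 'M[R]_(n, k) :=
  jacobian (f \o chart_inv K) (chart_map K p).

Definition smooth_map {k n : nat} (S : manifold R k) (M : manifold R n)
    (j : S -> M) : Prop :=
  continuous j /\
  forall (I : chart R k S) (K : chart R n M), atlas I -> atlas K ->
    smooth_on (chart_map I @` (chart_dom I `&` j @^-1` chart_dom K))
              (chart_map K \o j \o chart_inv I).

Definition immersion {k n : nat} (S : manifold R k) (M : manifold R n)
    (j : S -> M) : Prop :=
  smooth_map j /\
  forall (I : chart R k S) (K : chart R n M) (s : S), atlas I -> atlas K ->
    chart_dom I s -> chart_dom K (j s) ->
    row_free (differential I (chart_map K \o j) s).

End SmoothMaps.

(** ** Lorentzian space forms *)

(* The scalar product <X, Y>_s of R^m_s. *)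
Definition sprod {R : realType} {m : nat} (s : nat) (X Y : 'rV[R]_m) : R :=
  \sum_(i < m) (if (i < s)%N then - (X 0 i * Y 0 i) else X 0 i * Y 0 i).

(* The three possible values 0, 1, -1 of the curvature c. *)
Inductive curv := Czero | Cone | Cminus_one.

(* The ambient space of M^{n+1}_1(c) is R^(amb_dim c n)_(sig c). *)
Definition amb_dim (c : curv) (n : nat) : nat :=
  match c with Czero => n.+1 | Cone => n.+2 | Cminus_one => n.+2 end.

Definition sig (c : curv) : nat :=
  match c with Czero => 1 | Cone => 1 | Cminus_one => 2 end.

Section SpaceForm.
Context {R : realType} (c : curv) {n : nat}.
Implicit Types u w : 'rV[R]_(amb_dim c n).

Definition space_form : set 'rV[R]_(amb_dim c n) :=
  [set u | match c with
           | Czero => True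
           | Cone => sprod (sig c) u u = 1
           | Cminus_one => sprod (sig c) u u = -1
           end].

(* The tangent space of the space form at the point u. *)
Definition space_form_tangent u : set 'rV[R]_(amb_dim c n) :=
  [set w | match c with Czero => True | _ => sprod (sig c) u w = 0 end].

End SpaceForm.

(** ** Spacelike hypersurfaces and the Dupin condition *)

Section Hypersurface.
Context {R : realType} (c : curv) {n : nat} (M : manifold R n).
Implicit Types (x nu : M -> 'rV[R]_(amb_dim c n)) (O : set M).

Definition spacelike_hypersurface x : Prop :=
  [/\ forall p, space_form (x p),
      smooth_vfun setT x,
      forall K p, atlas K -> chart_dom K p -> row_free (differential K x p) &
      forall K p (v : 'rV[R]_n), atlas K -> chart_dom K p -> v != 0 ->
        0 < sprod (sig c) (v *m differential K x p) (v *m differential K x p)].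

(* nu is a smooth unit (timelike) normal vector field of x on O. *)
Definition unit_normal x O nu : Prop :=
  [/\ smooth_vfun O nu,
      forall p, O p -> space_form_tangent (x p) (nu p),
      forall p, O p -> sprod (sig c) (nu p) (nu p) = -1 &
      forall K p (v : 'rV[R]_n), atlas K -> chart_dom K p -> O p ->
        sprod (sig c) (v *m differential K x p) (nu p) = 0].

(* A is the matrix, in the chart K, of the shape operator of x at p for the   *)
(* unit normal nu: d nu (v) = - dx (A v).  No projection is needed for c <> 0,*)
(* where the Levi-Civita derivative of nu in the space form is the tangential *)
(* part of d nu (v): differentiating <nu, x> = 0 gives                        *)
(* <d nu (v), x> = - <nu, dx (v)> = 0.                                        *)
Definition shape_operator x nu (K : chart R n M) (p : M) (A : 'M[R]_n) : Prop :=
  differential K nu p = - (A *m differential K x p).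

(* j : S -> M is a curvature surface, with associated principal curvature lam *)
(* with respect to the unit normal nu, defined on the open set O containing   *)
(* it.  Submanifolds are connected injectively immersed ones.                 *)
Definition curvature_surface x O nu (k : nat) (S : manifold R k) (j : S -> M)
    (lam : S -> R) : Prop :=
  [/\ connected [set: S], injective j, immersion j, forall s, O (j s) &
      forall (s : S) (I : chart R k S) (K : chart R n M), atlas I -> atlas K ->
        chart_dom I s -> chart_dom K (j s) ->
        exists A : 'M[R]_n,
          [/\ shape_operator x nu K (j s) A,
              eigenvalue A (lam s) &
              (differential I (chart_map K \o j) s :=:
                 eigenspace A (lam s))%MS]].

(* Unit normals exist near every point and are unique up to a locally         *)
(* constant sign, so that it makes no difference whether they are taken       *)
(* globally or, as here, on open sets.                                        *)
Definition dupin x : Prop :=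
  forall (O : set M) nu, open O -> unit_normal x O nu ->
  forall (k : nat) (S : manifold R k) (j : S -> M) (lam : S -> R),
    curvature_surface x O nu j lam -> forall s t : S, lam s = lam t.

Definition spacelike_dupin_hypersurface x : Prop :=
  spacelike_hypersurface x /\ dupin x.

End Hypersurface.

(** ** Conformal transformations *)

Section Conformal.
Context {R : realType} (c : curv) {n : nat}.

(* The point [X] of the projective space RP^(n+2), as the line spanned by X   *)
(* in its canonical matrix form: for X, Y <> 0, [X] = [Y] iff X and Y are     *)
(* proportional.                                                              *)
Definition proj_point (X : 'rV[R]_n.+3) : 'M[R]_n.+3 := <<X>>%MS.

(* The group O(n+3, 2). *)
Definition pseudo_orthogonal (T : 'M[R]_n.+3) : Prop :=
  forall X Y : 'rV[R]_n.+3, sprod 2 (X *m T) (Y *m T) = sprod 2 X Y.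

(* The action T([X]) = [XT]. *)
Definition proj_act (T P : 'M[R]_n.+3) : 'M[R]_n.+3 := <<P *m T>>%MS.

(* The representative of sigma_c(u) in the light cone of R^(n+3)_2. *)
Definition sigma_vec : 'rV[R]_(amb_dim c n) -> 'rV[R]_n.+3 :=
  match c with
  | Czero => fun u : 'rV[R]_n.+1 =>
      castmx (erefl, addn1 n.+2)
        (row_mx (row_mx ((sprod 1 u u + 1) / 2)%:M u : 'rV[R]_n.+2)
                ((sprod 1 u u - 1) / 2)%:M)
  | Cone => fun u : 'rV[R]_n.+2 => (row_mx 1%:M u : 'rV[R]_(1 + n.+2))
  | Cminus_one => fun u : 'rV[R]_n.+2 =>
      castmx (erefl, addn1 n.+2) (row_mx u 1%:M)
  end.

Definition sigma (u : 'rV[R]_(amb_dim c n)) : 'M[R]_n.+3 :=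
  proj_point (sigma_vec u).

(* phi = sigma_c^-1 o T o sigma_c for some T in O(n+3, 2), as a partial map   *)
(* defined on the open dense subset D of the space form (the values of phi    *)
(* outside D are irrelevant).                                                 *)
Definition conformal_transformation (D : set 'rV[R]_(amb_dim c n))
    (phi : 'rV[R]_(amb_dim c n) -> 'rV[R]_(amb_dim c n)) : Prop :=
  [/\ exists2 V : set 'rV[R]_(amb_dim c n), open V & D = V `&` space_form (c:=c),
      space_form (c:=c) `<=` closure D &
      exists2 T : 'M[R]_n.+3, pseudo_orthogonal T &
        forall u, D u ->
          space_form (phi u) /\ sigma (phi u) = proj_act T (sigma u)].

End Conformal.

(* Main.v *)
Require Import Defs.
From mathcomp Require Import all_boot all_order all_algebra.
From mathcomp Require Import all_classical all_reals all_analysis.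
From mathcomp Require Import ring.
Import Order.TTheory GRing.Theory Num.Theory.
Import numFieldNormedType.Exports.

Set Implicit Arguments.
Unset Strict Implicit.
Unset Printing Implicit Defensive.

Local Open Scope classical_set_scope.
Local Open Scope ring_scope.

(** With [X = sigma_vec x] and [Y = sigma_vec y], where [y = phi \o x], conformality
    says [Y T^-1 = mu X] for a nowhere zero function [mu].  A unit normal [nu] of [y],
    lifted to the light cone and moved by [T^-1], differs by a multiple [a] of [X] from
    the lift of a unit normal of [x], and if [A] is the shape operator of [y] then that
    of [x] is [mu A + a].  So both hypersurfaces have the same curvature surfaces, with
    principal curvatures [lam] and [mu lam + a].  If the latter is a constant [C] along
    a curvature surface, then [lam = (C - a) / mu], and [da = - dmu A = - lam dmu] on
    its tangent vectors shows that [lam] has zero derivative. *)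

(** Both scalars come from one linear form, the height, which equals 1 on every lift: [mu] is the
    height of [Y T^-1], and [a] is the height of [N T^-1] for [N] the lifted normal. Subtracting
    [a X] is what brings the moved normal back to height 0, where the lifts of tangent vectors live;
    as [X] is null and orthogonal to its own derivatives, the scalar products do not feel it. Since
    [dN = - dY A], taking the height of [dN T^-1] gives [da = - dmu A] at once, in all three
    geometries alike.

    Unit normals and curvature surfaces are given for [y], whereas the Dupin condition is known for
    [x], so everything travels from [y] back to [x]; in the general sections [T] stands for what is
    [T^-1] above. Two regularity facts have to be produced on the way: that of [y], since [phi] is
    only known through lines in projective space, and that of [lam], which is an arbitrary function
    on the surface. *)

Lemma near_eq_differentiable (R : numFieldType) (V W : normedModType R)
    (f g : V -> W) (a : V) :
  (\forall z \near a, f z = g z) -> differentiable f a -> differentiable g a.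
Proof.
move=> fg df; have [dfc dfE] := (diff_locallyP a f).1 df.
have fga : f a = g a by exact: nbhs_singleton fg.
have dgE : g \o shift a = cst (g a) + 'd f a +o_ 0 id.
  apply/eqaddoP => e e0.
  move/eqaddoP : dfE => /(_ e e0); apply: filter_app.
  have : \forall h \near (0 : V), f (h + a) = g (h + a).
    by move: fg; rewrite (near_shift 0) subr0.
  by apply: filterS => h; rewrite !fctE /= fga => ->.
have dgf : 'd g a = 'd f a :> (V -> W) by exact: diff_unique.
by apply/diff_locallyP; rewrite dgf.
Qed.

(** * Smooth functions on open subsets of a normed space *)

Section DiffUpto.
Context {R : realType} {V : normedModType R}.

(** Graded by the order, because the Leibniz rule mixes a function with its derivatives: closure
    under products and inverses goes by induction on [k], with both kinds of factor available at
    order [k]. *)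
Fixpoint diff_upto {W : normedModType R} (k : nat) (U : set V) (f : V -> W) : Prop :=
  (forall u, U u -> differentiable f u) /\
  if k is k'.+1 then forall v, diff_upto k' U ('D_v f) else True.

Definition smooth {W : normedModType R} (U : set V) (f : V -> W) : Prop :=
  forall k, diff_upto k U f.

Lemma diff_upto_pred (W : normedModType R) k (U : set V) (f : V -> W) :
  diff_upto k.+1 U f -> diff_upto k U f.
Proof.
elim: k f => [|k IH] f [df Df]; first by split.
by split=> // v; apply: IH.
Qed.

Lemma smooth_differentiable (W : normedModType R) (U : set V) (f : V -> W) u :
  smooth U f -> U u -> differentiable f u.
Proof. by move=> /(_ 0%N)[df _]; exact: df. Qed.

Section OnOpen.
Context (U : set V) (oU : open U).

(** As [U] is open, agreement on it is agreement near each of its points, and so passes to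
    derivatives of every order. *)
Lemma diff_upto_eq (W : normedModType R) k (f g : V -> W) :
  (forall u, U u -> f u = g u) -> diff_upto k U f -> diff_upto k U g.
Proof.
elim: k f g => [|k IH] f g fg [df Df].
  split=> // u Uu; apply: near_eq_differentiable (df u Uu).
  by move/filterS: fg; apply; exact: open_nbhs_nbhs.
have near_fg u : U u -> \forall z \near u, f z = g z.
  by move=> Uu; move/filterS: fg; apply; exact: open_nbhs_nbhs.
split=> [u Uu|v].
  exact: near_eq_differentiable (near_fg u Uu) (df u Uu).
by apply: IH (Df v) => u Uu; exact: near_eq_derive (near_fg u Uu).
Qed.

Lemma smooth_eq (W : normedModType R) (f g : V -> W) :
  (forall u, U u -> f u = g u) -> smooth U f -> smooth U g.
Proof. by move=> fg sf k; exact: diff_upto_eq fg (sf k). Qed.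

Lemma diff_upto_cst (W : normedModType R) k (a : W) : diff_upto k U (cst a).
Proof.
elim: k a => [|k IH] a; first by split=> // u _; exact: differentiable_cst.
split=> [u _|v]; first exact: differentiable_cst.
by apply: diff_upto_eq (IH 0) => u _; rewrite derive_cst.
Qed.

Lemma diff_uptoD (W : normedModType R) k (f g : V -> W) :
  diff_upto k U f -> diff_upto k U g -> diff_upto k U (f \+ g).
Proof.
elim: k f g => [|k IH] f g [df Df] [dg Dg].
  by split=> // u Uu; apply: differentiableD; [exact: df|exact: dg].
split=> [u Uu|v]; first by apply: differentiableD; [exact: df|exact: dg].
apply: diff_upto_eq (IH _ _ (Df v) (Dg v)) => u Uu.
by rewrite [RHS]deriveD //; apply/diff_derivable; [exact: df|exact: dg].
Qed.

Lemma diff_uptoM k (f g : V -> R) :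
  diff_upto k U f -> diff_upto k U g -> diff_upto k U (f \* g).
Proof.
elim: k f g => [|k IH] f g sf sg; have [df Df] := sf; have [dg Dg] := sg.
  by split=> // u Uu; apply: differentiableM; [exact: df|exact: dg].
split=> [u Uu|v]; first by apply: differentiableM; [exact: df|exact: dg].
have := diff_uptoD (IH _ _ (diff_upto_pred sf) (Dg v))
  (IH _ _ (diff_upto_pred sg) (Df v)).
apply: diff_upto_eq => u Uu.
by rewrite [RHS]deriveM //; apply/diff_derivable; [exact: df|exact: dg].
Qed.

Lemma diff_uptoV k (f : V -> R) : (forall u, U u -> f u != 0) ->
  diff_upto k U f -> diff_upto k U (fun u => (f u)^-1).
Proof.
move=> f0; elim: k => [|k IH] sf; have [df Df] := sf.
  by split=> // u Uu; apply: differentiableV; [exact: df|exact: f0].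
split=> [u Uu|v]; first by apply: differentiableV; [exact: df|exact: f0].
(* The derivative [- f^-1 * f^-1 * 'D_v f] contains the inverse again, but only one order lower is
   asked of it. *)
have sV := IH (diff_upto_pred sf).
have := diff_uptoM (diff_upto_cst k (-1 : R)) (diff_uptoM (diff_uptoM sV sV) (Df v)).
apply: diff_upto_eq => u Uu.
rewrite deriveV ?f0 //; last exact/diff_derivable/df.
by rewrite /cst /= mulN1r expr2 invfM scaleNr.
Qed.

Lemma smooth_cst (W : normedModType R) (a : W) : smooth U (fun=> a).
Proof. by move=> k; exact: diff_upto_cst. Qed.

Lemma smoothD (W : normedModType R) (f g : V -> W) :
  smooth U f -> smooth U g -> smooth U (fun u => f u + g u).
Proof. by move=> sf sg k; exact: diff_uptoD. Qed.

Lemma smoothM (f g : V -> R) :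
  smooth U f -> smooth U g -> smooth U (fun u => f u * g u).
Proof. by move=> sf sg k; exact: diff_uptoM. Qed.

Lemma smoothV (f : V -> R) : (forall u, U u -> f u != 0) ->
  smooth U f -> smooth U (fun u => (f u)^-1).
Proof. by move=> f0 sf k; exact: diff_uptoV. Qed.

Lemma smoothN (f : V -> R) : smooth U f -> smooth U (fun u => - f u).
Proof.
move=> sf; apply: smooth_eq (smoothM (smooth_cst (-1 : R)) sf) => u _.
by rewrite mulN1r.
Qed.

Lemma smooth_sum (W : normedModType R) m (f : 'I_m -> V -> W) :
  (forall i, smooth U (f i)) -> smooth U (fun u => \sum_(i < m) f i u).
Proof.
elim: m f => [|m IH] f sf.
  by apply: smooth_eq (smooth_cst 0) => u _; rewrite big_ord0.
have := smoothD (IH _ (fun i => sf (widen_ord (leqnSn m) i))) (sf ord_max).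
by apply: smooth_eq => u _; rewrite big_ord_recr.
Qed.

Lemma differentiable_rowP m (f : V -> 'rV[R]_m) u :
  differentiable f u <-> forall i, differentiable (fun z => f z 0 i) u.
Proof.
split=> [df i|df].
  exact: (differentiable_comp df (differentiable_coord (f u) 0 i)).
have -> : f = \sum_(i < m) (fun z => f z 0 i *: (delta_mx 0 i : 'rV[R]_m)).
  by apply/funext => z; rewrite fct_sumE [LHS]row_sum_delta.
by apply: differentiable_sum => i; exact: differentiableZl.
Qed.

Lemma derive_row m (f : V -> 'rV[R]_m) u v i :
  derivable f u v -> ('D_v f u) 0 i = 'D_v (fun z => f z 0 i) u.
Proof. by move=> df; rewrite derive_mx // mxE. Qed.

Lemma diff_upto_rowP m k (f : V -> 'rV[R]_m) :
  diff_upto k U f <-> forall i, diff_upto k U (fun z => f z 0 i).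
Proof.
elim: k f => [|k IH] f; split.
- by move=> [df _] i; split=> // u Uu; have /differentiable_rowP := df u Uu.
- by move=> H; split=> // u Uu; apply/differentiable_rowP => i; exact: (H i).1.
- move=> [df Df] i; split=> [u Uu|v].
    by have /differentiable_rowP := df u Uu.
  move: (Df v) => /IH /(_ i); apply: diff_upto_eq => u Uu.
  by rewrite derive_row //; exact/diff_derivable/df.
- move=> H; have df u : U u -> differentiable f u.
    by move=> Uu; apply/differentiable_rowP => i; exact: (H i).1.
  split=> // v; apply/IH => i; apply: diff_upto_eq ((H i).2 v) => u Uu.
  by rewrite derive_row //; exact/diff_derivable/df.
Qed.

Lemma smooth_rowP m (f : V -> 'rV[R]_m) :
  smooth U f <-> forall i, smooth U (fun z => f z 0 i).
Proof.
split=> [sf i k|sf k]; first by move: i; apply/diff_upto_rowP.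
by apply/diff_upto_rowP => i; exact: sf.
Qed.

Lemma smooth_mulmx m l (A : 'M[R]_(m, l)) (f : V -> 'rV[R]_m) :
  smooth U f -> smooth U (fun u => f u *m A).
Proof.
move=> /smooth_rowP sf; apply/smooth_rowP => j.
have := smooth_sum (fun i => smoothM (sf i) (smooth_cst (A i j : R))).
by apply: smooth_eq => u _; rewrite mxE.
Qed.

Lemma smoothZ m (a : V -> R) (f : V -> 'rV[R]_m) :
  smooth U a -> smooth U f -> smooth U (fun u => a u *: f u).
Proof.
move=> sa /smooth_rowP sf; apply/smooth_rowP => j.
by apply: smooth_eq (smoothM sa (sf j)) => u _; rewrite mxE.
Qed.

Lemma smooth_sprod m s (f g : V -> 'rV[R]_m) :
  smooth U f -> smooth U g -> smooth U (fun u => sprod s (f u) (g u)).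
Proof.
move=> /smooth_rowP sf /smooth_rowP sg; apply: smooth_sum => i.
by case: (i < s)%N; [apply/smoothN/smoothM|apply: smoothM].
Qed.

End OnOpen.
End DiffUpto.

(** [foldr] applies the head of the list last, whereas [diff_upto] differentiates [f] itself first;
    hence directions are peeled off the end of the list. *)
Lemma smooth_onP (R : realType) m l (U : set 'rV[R]_m) (f : 'rV[R]_m -> 'rV[R]_l) :
  smooth_on U f <-> smooth U f.
Proof.
split=> [sf k|sf vs].
  elim: k f sf => [|k IH] f sf; first by split=> // u; exact: (sf [::]).
  split=> [u|v]; first exact: (sf [::]).
  by apply: IH => vs; move: (sf (rcons vs v)); rewrite /iter_derive foldr_rcons.
elim/last_ind: vs f sf => [|vs v IH] f sf u Uu.
  exact: smooth_differentiable sf Uu.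
rewrite /iter_derive foldr_rcons; apply: IH => // k.
exact: (sf k.+1).2.
Qed.

(** * The scalar product of index [s] *)

Section ScalarProduct.
Context {R : realType} (s : nat).

Lemma sprodC m (X Y : 'rV[R]_m) : sprod s X Y = sprod s Y X.
Proof. by apply: eq_bigr => i _; rewrite mulrC. Qed.

Lemma sprodDl m (X Y Z : 'rV[R]_m) : sprod s (X + Y) Z = sprod s X Z + sprod s Y Z.
Proof.
rewrite -big_split; apply: eq_bigr => i _ /=; rewrite mxE mulrDl.
by case: ifP => //; rewrite opprD.
Qed.

Lemma sprodZl m a (X Y : 'rV[R]_m) : sprod s (a *: X) Y = a * sprod s X Y.
Proof.
rewrite /sprod mulr_sumr; apply: eq_bigr => i _ /=; rewrite mxE -mulrA.
by case: ifP => //; rewrite mulrN.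
Qed.

Lemma sprodDr m (X Y Z : 'rV[R]_m) : sprod s Z (X + Y) = sprod s Z X + sprod s Z Y.
Proof. by rewrite !(sprodC Z) sprodDl. Qed.

Lemma sprodZr m a (X Y : 'rV[R]_m) : sprod s X (a *: Y) = a * sprod s X Y.
Proof. by rewrite !(sprodC X) sprodZl. Qed.

Lemma sprodNl m (X Y : 'rV[R]_m) : sprod s (- X) Y = - sprod s X Y.
Proof. by rewrite -scaleN1r sprodZl mulN1r. Qed.

Lemma sprodNr m (X Y : 'rV[R]_m) : sprod s X (- Y) = - sprod s X Y.
Proof. by rewrite !(sprodC X) sprodNl. Qed.

Lemma sprod0l m (X : 'rV[R]_m) : sprod s 0 X = 0.
Proof. by rewrite -(scale0r 0) sprodZl mul0r. Qed.

Lemma sprod0r m (X : 'rV[R]_m) : sprod s X 0 = 0.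
Proof. by rewrite sprodC sprod0l. Qed.

Definition sprodE := (sprodDl, sprodDr, sprodNl, sprodNr, sprodZl, sprodZr).

Lemma sprod_castmx m m' (e : m = m') (X Y : 'rV[R]_m) :
  sprod s (castmx (erefl, e) X) (castmx (erefl, e) Y) = sprod s X Y.
Proof. by case: m' / e. Qed.

Lemma sprod_row_mx m (X X' : 'rV[R]_m) (z z' : 'rV[R]_1) : (s <= m)%N ->
  sprod s (row_mx X z) (row_mx X' z') = sprod s X X' + z 0 0 * z' 0 0.
Proof.
move=> sm; rewrite /sprod big_split_ord big_ord1 /=; congr (_ + _).
  by apply: eq_bigr => i _; rewrite !row_mxEl.
by rewrite !row_mxEr addn0 ltnNge sm.
Qed.

Lemma sprod_row_mx_timelike m (X X' : 'rV[R]_m) (z z' : 'rV[R]_1) :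
  sprod s.+1 (row_mx z X) (row_mx z' X') = - (z 0 0 * z' 0 0) + sprod s X X'.
Proof.
rewrite /sprod big_split_ord big_ord1 /= !row_mxEl; congr (_ + _).
by apply: eq_bigr => i _; rewrite !row_mxEr add1n ltnS.
Qed.

End ScalarProduct.

(** * Directional derivatives of row-valued functions *)

Section DeriveRow.
Context {R : realType} {V : normedModType R}.
Implicit Types (u v : V).

Lemma is_derive_rowP m (F : V -> 'rV[R]_m) dF u v :
  is_derive u v F dF <-> forall i, is_derive u v (fun z => F z 0 i) (dF 0 i).
Proof.
split=> [[dF' <-] i|dF'].
  by rewrite derive_row //; apply: derivableP; move/derivable_mxP: dF'; exact.
have F' : derivable F u v.
  by apply/derivable_mxP => i j; rewrite (ord1 i); by case: (dF' j).
apply: DeriveDef => //; apply/rowP => i.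
by rewrite derive_row //; case: (dF' i).
Qed.

Lemma is_derive_sum_ord m (f : 'I_m -> V -> R) (df : 'I_m -> R) u v :
  (forall i, is_derive u v (f i) (df i)) ->
  is_derive u v (fun z => \sum_(i < m) f i z) (\sum_(i < m) df i).
Proof.
by move=> /is_derive_sum; rewrite (_ : (fun _ => _) = \sum_(i < m) f i) // funeqE => z;
  rewrite fct_sumE.
Qed.

Lemma is_derive_mul (f g : V -> R) df dg u v :
  is_derive u v f df -> is_derive u v g dg ->
  is_derive u v (fun z => f z * g z) (df * g u + f u * dg).
Proof.
move=> Df Dg; apply: is_derive_eq (is_deriveM Df Dg) _.
by rewrite /GRing.scale /= addrC [g u * _]mulrC.
Qed.

Lemma is_derive_mulmx m l (A : 'M[R]_(m, l)) (F : V -> 'rV[R]_m) dF u v :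
  is_derive u v F dF -> is_derive u v (fun z => F z *m A) (dF *m A).
Proof.
move=> /is_derive_rowP H; apply/is_derive_rowP => j; rewrite mxE.
under [X in is_derive _ _ X _]funext do rewrite mxE.
apply: is_derive_sum_ord => i.
apply: is_derive_eq (is_derive_mul (H i) (is_derive_cst (A i j : R) u v)) _.
by rewrite mulr0 addr0.
Qed.

Lemma is_derive_scale m (a : V -> R) (F : V -> 'rV[R]_m) da dF u v :
  is_derive u v a da -> is_derive u v F dF ->
  is_derive u v (fun z => a z *: F z) (da *: F u + a u *: dF).
Proof.
move=> Ha /is_derive_rowP H; apply/is_derive_rowP => j; rewrite !mxE.
under [X in is_derive _ _ X _]funext do rewrite mxE.
exact: is_derive_mul.
Qed.

Lemma is_derive_sprod m s (F G : V -> 'rV[R]_m) dF dG u v :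
  is_derive u v F dF -> is_derive u v G dG ->
  is_derive u v (fun z => sprod s (F z) (G z)) (sprod s dF (G u) + sprod s (F u) dG).
Proof.
move=> /is_derive_rowP HF /is_derive_rowP HG; rewrite -big_split.
apply: is_derive_sum_ord => i /=.
have := is_derive_mul (HF i) (HG i); case: ifP => // _ H.
by rewrite -opprD; exact: is_deriveN.
Qed.

End DeriveRow.

(** * Block coordinates on R^(n+3) *)

Section Coordinates.
Context {R : realType} {n : nat}.

Lemma castmx_mul m p q q' (eq : q = q') (A : 'M[R]_(m, p)) (B : 'M[R]_(p, q)) :
  A *m castmx (erefl, eq) B = castmx (erefl, eq) (A *m B).
Proof. by case: q' / eq. Qed.

Lemma castmx_mul_tr m p q q' (eq : q = q') (A : 'M[R]_(m, q)) (B : 'M[R]_(p, q)) :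
  castmx (erefl, eq) A *m (castmx (erefl, eq) B)^T = A *m B^T.
Proof. by case: q' / eq. Qed.

Lemma castmxD m q q' (eq : q = q') (A B : 'M[R]_(m, q)) :
  castmx (erefl, eq) A + castmx (erefl, eq) B = castmx (erefl, eq) (A + B).
Proof. by case: q' / eq. Qed.

Lemma castmxZ m q q' (eq : q = q') a (A : 'M[R]_(m, q)) :
  a *: castmx (erefl, eq) A = castmx (erefl, eq) (a *: A).
Proof. by case: q' / eq. Qed.

Definition row_first (m : nat) (a : R) (B : 'rV[R]_m) : 'rV[R]_m.+1 :=
  row_mx (a%:M : 'rV_1) B.

Definition row_last (B : 'rV[R]_n.+2) (z : R) : 'rV[R]_n.+3 :=
  castmx (erefl, addn1 n.+2) (row_mx B (z%:M : 'rV_1)).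

Lemma row_firstD m a a' (B B' : 'rV[R]_m) :
  row_first a B + row_first a' B' = row_first (a + a') (B + B').
Proof. by rewrite /row_first raddfD /= -add_row_mx. Qed.

Lemma row_lastD a a' B B' : row_last B a + row_last B' a' = row_last (B + B') (a + a').
Proof. by rewrite /row_last raddfD /= -add_row_mx castmxD. Qed.

Lemma row_firstZ m k a (B : 'rV[R]_m) : k *: row_first a B = row_first (k * a) (k *: B).
Proof. by rewrite /row_first -scale_scalar_mx -scale_row_mx. Qed.

Lemma row_lastZ k B a : k *: row_last B a = row_last (k *: B) (k * a).
Proof. by rewrite /row_last -scale_scalar_mx -scale_row_mx castmxZ. Qed.

Lemma row_firstP m (Z : 'rV[R]_m.+1) : exists a B, Z = row_first a B.
Proof.
exists ((lsubmx (Z : 'rV_(1 + m))) 0 0), (rsubmx (Z : 'rV_(1 + m))).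
by rewrite /row_first -mx11_scalar hsubmxK.
Qed.

Lemma row_lastP Z : exists B z, Z = row_last B z.
Proof.
pose Z' := castmx (erefl, esym (addn1 n.+2)) Z.
exists (lsubmx Z'), ((rsubmx Z') 0 0).
by rewrite /row_last -mx11_scalar hsubmxK castmxKV.
Qed.

Lemma sprod_row_first m s a a' (B B' : 'rV[R]_m) :
  sprod s.+1 (row_first a B) (row_first a' B') = - (a * a') + sprod s B B'.
Proof. by rewrite sprod_row_mx_timelike !mxE !mulr1n. Qed.

Lemma sprod_row_last B B' z z' :
  sprod 2 (row_last B z) (row_last B' z') = sprod 2 B B' + z * z'.
Proof. by rewrite sprod_castmx sprod_row_mx // !mxE !mulr1n. Qed.

End Coordinates.

(** * The three maps [sigma_vec] in one formula *)

Section LightCone.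
Context {R : realType} (c : curv) {n : nat}.

(* [sigma_vec u = cone_base + u *m cone_embed + (<u, u> / 2) *: cone_infty];   *)
(* [cone_height] is the linear form equal to 1 on the whole image of sigma_vec. *)
Definition cone_embed : 'M[R]_(amb_dim c n, n.+3) :=
  match c with
  | Czero => castmx (erefl, addn1 n.+2)
      (row_mx (row_mx 0 1%:M : 'M[R]_(n.+1, 1 + n.+1)) 0)
  | Cone => (row_mx 0 1%:M : 'M[R]_(n.+2, 1 + n.+2))
  | Cminus_one => castmx (erefl, addn1 n.+2) (row_mx 1%:M 0)
  end.

(** The value of the formula for [sigma_vec] at 0, although 0 lies on the space form only for c =
    0. *)
Definition cone_base : 'rV[R]_n.+3 :=
  match c with
  | Czero => row_last (row_first 2^-1 0) (- 2^-1)
  | Cone => row_first 1 0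
  | Cminus_one => row_last 0 1
  end.

(** For c = 0 it spans a point of the quadric at infinity, which [sigma] misses; for the other two
    values of c the lift is affine in [u], whence 0. *)
Definition cone_infty : 'rV[R]_n.+3 :=
  match c with Czero => row_last (row_first 1 0) 1 | _ => 0 end.

Definition cone_height (Z : 'rV[R]_n.+3) : R :=
  match c with
  | Czero => - sprod 2 Z cone_infty
  | Cone => - sprod 2 Z cone_base
  | Cminus_one => sprod 2 Z cone_base
  end.

End LightCone.
Arguments cone_embed {R} c n.
Arguments cone_base {R} c n.
Arguments cone_infty {R} c n.
Arguments cone_height {R} c {n}.

Section LightConeTheory.
Context {R : realType} {c : curv} {n : nat}.
Implicit Types (u w : 'rV[R]_(amb_dim c n)) (Z : 'rV[R]_n.+3).
Local Notation J := (cone_embed c n).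
Local Notation e := (cone_base c n).
Local Notation f := (cone_infty c n).

Lemma mul_embed0 (u : 'rV[R]_n.+1) :
  u *m cone_embed Czero n = row_last (row_first 0 u) 0.
Proof.
rewrite /row_last /row_first !raddf0 /cone_embed castmx_mul; congr castmx.
by rewrite mul_mx_row (mul_mx_row u (0 : 'M[R]_(_, 1)) 1%:M) !mulmx0 mulmx1.
Qed.

Lemma mul_embed1 (u : 'rV[R]_n.+2) : u *m cone_embed Cone n = row_first 0 u.
Proof. by rewrite /row_first raddf0 (mul_mx_row u (0 : 'M[R]_(_, 1)) 1%:M) mulmx0 mulmx1. Qed.

Lemma mul_embedN1 (u : 'rV[R]_n.+2) : u *m cone_embed Cminus_one n = row_last u 0.
Proof.
by rewrite /row_last raddf0 /cone_embed castmx_mul mul_mx_row mulmx0 mulmx1.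
Qed.

Definition mul_embed := (mul_embed0, mul_embed1, mul_embedN1).

Lemma mul_tr_embed0 a (B : 'rV[R]_n.+1) z :
  row_last (row_first a B) z *m (cone_embed Czero n)^T = B.
Proof.
rewrite /row_last /row_first /cone_embed castmx_mul_tr tr_row_mx mul_row_col.
rewrite trmx0 mulmx0 addr0 (tr_row_mx (0 : 'M[R]_(_, 1)) 1%:M) (mul_row_col a%:M B (0 : 'M[R]_(_, 1))^T 1%:M^T).
by rewrite trmx0 trmx1 mulmx0 add0r mulmx1.
Qed.

Lemma mul_tr_embed1 a (B : 'rV[R]_n.+2) : row_first a B *m (cone_embed Cone n)^T = B.
Proof.
rewrite /row_first /cone_embed (tr_row_mx (0 : 'M[R]_(_, 1)) 1%:M) (mul_row_col a%:M B (0 : 'M[R]_(_, 1))^T 1%:M^T).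
by rewrite trmx0 trmx1 mulmx0 add0r mulmx1.
Qed.

Lemma mul_tr_embedN1 (B : 'rV[R]_n.+2) z :
  row_last B z *m (cone_embed Cminus_one n)^T = B.
Proof.
rewrite /row_last /cone_embed castmx_mul_tr tr_row_mx mul_row_col.
by rewrite trmx0 trmx1 mulmx0 addr0 mulmx1.
Qed.

Definition mul_tr_embed := (mul_tr_embed0, mul_tr_embed1, mul_tr_embedN1).

Local Notation coordE := (row_firstD, row_firstZ, row_lastD, row_lastZ,
  sprod_row_last, sprod_row_first, sprod0l, sprod0r, scaler0, addr0, add0r,
  mulr0, mul0r, mulr1, mul1r, oppr0).

Lemma sigma_vecE u : sigma_vec u = e + u *m J + (sprod (sig c) u u / 2) *: f.
Proof.
rewrite /cone_base /cone_infty; case: c u => u; rewrite mul_embed !coordE //=.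
rewrite -/(row_first _ _) -/(row_last _ _).
by congr (row_last (row_first _ _) _); field.
Qed.

Lemma sprod_embed u w : sprod 2 (u *m J) (w *m J) = sprod (sig c) u w.
Proof. by case: c u w => u w; rewrite !mul_embed !coordE. Qed.

Lemma sprod_embed_base w : sprod 2 (w *m J) e = 0.
Proof. by rewrite /cone_base; case: c w => w; rewrite !mul_embed !coordE. Qed.

Lemma sprod_embed_infty w : sprod 2 (w *m J) f = 0.
Proof. by rewrite /cone_infty; case: c w => w; rewrite !mul_embed !coordE. Qed.

Lemma sprod_infty : sprod 2 f f = 0 :> R.
Proof. by rewrite /cone_infty; case: c; rewrite !coordE ?addNr. Qed.

Lemma sprod_base :
  sprod 2 e e = match c with Czero => 0 | Cone => -1 | Cminus_one => 1 end :> R.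
Proof. by rewrite /cone_base; case: c; rewrite !coordE // mulrNN addNr. Qed.

Lemma sprod_base_infty :
  sprod 2 e f = match c with Czero => -1 | _ => 0 end :> R.
Proof. by rewrite /cone_base /cone_infty; case: c; rewrite !coordE //; field. Qed.

Lemma cone_embedK u : u *m J *m J^T = u.
Proof. by case: c u => u; rewrite mul_embed mul_tr_embed. Qed.

Lemma cone_base_tr : e *m J^T = 0 :> 'rV[R]_(amb_dim c n).
Proof. by rewrite /cone_base; case: c; rewrite mul_tr_embed. Qed.

Lemma cone_infty_tr : f *m J^T = 0 :> 'rV[R]_(amb_dim c n).
Proof. by rewrite /cone_infty; case: c; rewrite ?mul0mx ?mul_tr_embed. Qed.

Lemma cone_heightD Z Z' : cone_height c (Z + Z') = cone_height c Z + cone_height c Z'.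
Proof. by rewrite /cone_height; case: c; rewrite sprodDl ?opprD. Qed.

Lemma cone_heightZ a Z : cone_height c (a *: Z) = a * cone_height c Z.
Proof. by rewrite /cone_height; case: c; rewrite sprodZl ?mulrN. Qed.

Lemma cone_height_embed w : cone_height c (w *m J) = 0.
Proof.
have := sprod_embed_base w; have := sprod_embed_infty w.
by rewrite /cone_height; case: c w => w h h'; rewrite ?h ?h' ?oppr0.
Qed.

Lemma cone_height_base : cone_height c e = 1 :> R.
Proof.
have := sprod_base; have := sprod_base_infty.
by rewrite /cone_height; case: c => h h'; rewrite ?h ?h' ?opprK.
Qed.

Lemma cone_height_infty : cone_height c f = 0 :> R.
Proof.
rewrite /cone_height; have := sprod_infty; case: c => h; rewrite ?h ?oppr0 //;
  by rewrite /cone_infty sprod0l ?oppr0.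
Qed.

(** The image of [J] is the orthogonal complement of [e] and [f]. For c = 0 these are null vectors
    with product -1, so each coefficient is minus the product with the other vector; otherwise
    [f = 0] and [e] has square 1 or -1, the sign being absorbed in [cone_height]. *)
Lemma cone_decomp Z :
  Z = cone_height c Z *: e + (Z *m J^T) *m J - sprod 2 Z e *: f.
Proof.
rewrite /cone_height /cone_infty /cone_base -scaleNr; case: c => /=.
- have [A [z ->]] := row_lastP Z; have [a [B ->]] := row_firstP A.
  rewrite mul_tr_embed mul_embed !coordE.
  by congr (row_last (row_first _ _) _); field.
- have [a [B ->]] := row_firstP Z.
  by rewrite mul_tr_embed mul_embed !coordE opprK.
- have [B [z ->]] := row_lastP Z.
  by rewrite mul_tr_embed mul_embed !coordE.
Qed.

End LightConeTheory.

(** * Lifts of points and of tangent vectors *)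

Section Lift.
Context {R : realType} {c : curv} {n : nat}.
Implicit Types (u w : 'rV[R]_(amb_dim c n)) (N : 'rV[R]_n.+3).
Local Notation J := (cone_embed c n).
Local Notation e := (cone_base c n).
Local Notation f := (cone_infty c n).

(* Locked, lest rewriting with [sprodDl] unfold it. *)
Definition dsigma_vec u w : 'rV[R]_n.+3 := locked (w *m J + sprod (sig c) u w *: f).

Lemma dsigma_vecE u w : dsigma_vec u w = w *m J + sprod (sig c) u w *: f.
Proof. by rewrite /dsigma_vec -lock. Qed.

Lemma dsigma_vecZ u a w : dsigma_vec u (a *: w) = a *: dsigma_vec u w.
Proof. by rewrite !dsigma_vecE -scalemxAl sprodZr scalerDr scalerA. Qed.

Lemma dsigma_vecN u w : dsigma_vec u (- w) = - dsigma_vec u w.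
Proof. by rewrite -scaleN1r dsigma_vecZ scaleN1r. Qed.

Lemma sprod_dsigma_vec u w w' :
  sprod 2 (dsigma_vec u w) (dsigma_vec u w') = sprod (sig c) w w'.
Proof.
rewrite !dsigma_vecE !sprodE sprod_embed sprod_infty (sprodC 2 f) !sprod_embed_infty.
by rewrite !mulr0 !addr0 mulr0 addr0.
Qed.

Lemma dsigma_vecK u w : dsigma_vec u w *m J^T = w.
Proof. by rewrite dsigma_vecE mulmxDl cone_embedK -scalemxAl cone_infty_tr scaler0 addr0. Qed.

Lemma cone_height_sigma u : cone_height c (sigma_vec u) = 1.
Proof.
rewrite sigma_vecE !cone_heightD cone_heightZ cone_height_base cone_height_embed.
by rewrite cone_height_infty mulr0 !addr0.
Qed.

Lemma sigma_vecK u : sigma_vec u *m J^T = u.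
Proof.
rewrite sigma_vecE !mulmxDl cone_embedK -scalemxAl cone_infty_tr scaler0 addr0.
by rewrite cone_base_tr add0r.
Qed.

Lemma sprod_sigma_vec u : space_form u -> sprod 2 (sigma_vec u) (sigma_vec u) = 0.
Proof.
move=> hu; rewrite sigma_vecE !sprodE sprod_embed sprod_infty !(sprodC 2 f).
rewrite !sprod_embed_infty (sprodC 2 e (u *m J)) sprod_embed_base.
rewrite sprod_base sprod_base_infty.
by case: c u hu => u /= => [_|->|->]; field.
Qed.

Lemma sprod_dsigma_sigma u w : space_form_tangent u w ->
  sprod 2 (dsigma_vec u w) (sigma_vec u) = 0.
Proof.
move=> hw; rewrite sigma_vecE dsigma_vecE !sprodE sprod_embed sprod_infty !(sprodC 2 f).
rewrite !sprod_embed_infty sprod_embed_base sprod_base_infty (sprodC _ w).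
by case: c u w hw => u w /= => [_|->|->]; field.
Qed.

(** Height 0 removes the [e] component of [cone_decomp], and orthogonality to the lift of [u] reads
    [<N, e> + <u, w> = 0], which identifies the coefficient of [f]. For c = 1 or -1 the height is
    [<N, e>] up to sign, so the same equation gives tangency. This recovers a tangent vector from
    its lift. *)
Lemma orthogonal_sigma_dsigma u N :
  cone_height c N = 0 -> sprod 2 N (sigma_vec u) = 0 ->
  space_form_tangent u (N *m J^T) /\ N = dsigma_vec u (N *m J^T).
Proof.
move=> hN NS; set w := N *m J^T.
have NE : N = w *m J - sprod 2 N e *: f.
  by rewrite [LHS](cone_decomp (c := c)) hN scale0r add0r.
have NuJ : sprod 2 N (u *m J) = sprod (sig c) u w.
  rewrite NE sprodDl sprodNl sprodZl (sprodC 2 f) sprod_embed_infty mulr0 subr0.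
  by rewrite sprod_embed sprodC.
have Nf : sprod 2 N f = 0.
  by rewrite NE sprodDl sprodNl sprodZl sprod_infty sprod_embed_infty mulr0 subrr.
move: NS; rewrite sigma_vecE !sprodDr sprodZr NuJ Nf mulr0 addr0 => /eqP.
rewrite addr_eq0 => /eqP Ne; rewrite dsigma_vecE [N in N = _]NE Ne scaleNr opprK.
split=> //; have /eqP := Ne; rewrite -addr_eq0.
move: hN w {NE NuJ Nf Ne}; rewrite /space_form_tangent /cone_height.
case: c u N => u N //= /eqP.
  by rewrite oppr_eq0 => /eqP -> w; rewrite add0r => /eqP.
by move=> /eqP -> w; rewrite add0r => /eqP.
Qed.

(** The base point moves as well, which produces the second term; it vanishes when [nu] is normal to
    [dx]. *)
Lemma is_derive_dsigma_vec (V : normedModType R) (x nu : V -> 'rV[R]_(amb_dim c n))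
    dx dnu p v :
  is_derive p v x dx -> is_derive p v nu dnu ->
  is_derive p v (fun q => dsigma_vec (x q) (nu q))
    (dsigma_vec (x p) dnu + sprod (sig c) dx (nu p) *: f).
Proof.
move=> Hx Hn; under [X in is_derive _ _ X _]funext do rewrite dsigma_vecE.
have := is_deriveD (is_derive_mulmx J Hn)
  (is_derive_scale (is_derive_sprod (sig c) Hx Hn) (is_derive_cst f p v)).
move=> /is_derive_eq; apply.
by rewrite dsigma_vecE scaler0 addr0 scalerDl addrCA addrC [X in X + _]addrC -addrA.
Qed.

Lemma is_derive_sigma_vec (V : normedModType R) (x : V -> 'rV[R]_(amb_dim c n))
    dx p v :
  is_derive p v x dx ->
  is_derive p v (fun q => sigma_vec (x q)) (dsigma_vec (x p) dx).
Proof.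
move=> Hx; under [X in is_derive _ _ X _]funext do rewrite sigma_vecE.
have Hq := is_derive_mul (is_derive_sprod (sig c) Hx Hx) (is_derive_cst (2^-1 : R) p v).
have := is_deriveD (is_deriveD (is_derive_cst e p v) (is_derive_mulmx J Hx))
  (is_derive_scale Hq (is_derive_cst f p v)).
move=> /is_derive_eq; apply.
rewrite dsigma_vecE scaler0 addr0 add0r mulr0 addr0 (sprodC _ dx).
by rewrite /cst /=; congr (_ + _ *: _); field.
Qed.

Lemma is_derive_cone_height (V : normedModType R) (F : V -> 'rV[R]_n.+3) dF p v :
  is_derive p v F dF ->
  is_derive p v (fun q => cone_height c (F q)) (cone_height c dF).
Proof.
move=> HF; rewrite /cone_height.
have H (a : 'rV[R]_n.+3) :
    is_derive p v (fun q => sprod 2 (F q) a) (sprod 2 dF a).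
  by apply: is_derive_eq (is_derive_sprod 2 HF (is_derive_cst a p v)) _;
     rewrite sprod0r addr0.
by case: c; [apply: is_deriveN| apply: is_deriveN|].
Qed.

Lemma smooth_sigma_vec (V : normedModType R) (U : set V) (oU : open U)
    (x : V -> 'rV[R]_(amb_dim c n)) :
  smooth U x -> smooth U (fun q => sigma_vec (x q)).
Proof.
move=> sx; under [X in smooth _ X]funext do rewrite sigma_vecE.
apply: smoothD => //; [apply: smoothD => //|apply: smoothZ => //].
- exact: smooth_cst.
- exact: smooth_mulmx.
- by apply: smoothM => //; [exact: smooth_sprod|exact: smooth_cst].
- exact: smooth_cst.
Qed.

Lemma smooth_dsigma_vec (V : normedModType R) (U : set V) (oU : open U)
    (x nu : V -> 'rV[R]_(amb_dim c n)) :
  smooth U x -> smooth U nu -> smooth U (fun q => dsigma_vec (x q) (nu q)).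
Proof.
move=> sx sn; under [X in smooth _ X]funext do rewrite dsigma_vecE.
apply: smoothD => //; first exact: smooth_mulmx.
by apply: smoothZ => //; [exact: smooth_sprod|exact: smooth_cst].
Qed.

Lemma smooth_cone_height (V : normedModType R) (U : set V) (oU : open U)
    (F : V -> 'rV[R]_n.+3) :
  smooth U F -> smooth U (fun q => cone_height c (F q)).
Proof.
move=> sF; rewrite /cone_height; have H (a : 'rV[R]_n.+3) :
    smooth U (fun q => sprod 2 (F q) a).
  by apply: smooth_sprod => //; exact: smooth_cst.
by case: c; [exact: smoothN|exact: smoothN|].
Qed.

End Lift.

(** * Conformal factor and transported normal *)

Section PullbackNormal.
Context {R : realType} {c : curv} {n : nat} {V : Type}.
Context (T : 'M[R]_n.+3) (x y nu : V -> 'rV[R]_(amb_dim c n)).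

(** Taking heights in [Y T = mu X] yields [mu], since the lift [X] has height 1. *)
Definition conf_factor p : R := cone_height c (sigma_vec (y p) *m T).

(** The multiple of [X] whose removal gives the moved normal height 0. *)
Definition normal_shift p : R := cone_height c (dsigma_vec (y p) (nu p) *m T).

Definition pullback_normal p : 'rV[R]_(amb_dim c n) :=
  dsigma_vec (y p) (nu p) *m T *m (cone_embed c n)^T - normal_shift p *: x p.

End PullbackNormal.

Section ConformalPoint.
Context {R : realType} {c : curv} {n : nat} {V : Type}.
Context (T : 'M[R]_n.+3) (x y nu : V -> 'rV[R]_(amb_dim c n)) (p : V).
Hypothesis orthT : pseudo_orthogonal T.
Hypothesis xS : space_form (x p).
Hypothesis mu_neq0 : conf_factor T y p != 0.
Hypothesis sigma_yT : sigma_vec (y p) *m T = conf_factor T y p *: sigma_vec (x p).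
Hypothesis nu_tangent : space_form_tangent (y p) (nu p).
Local Notation normal_shift := (normal_shift T y nu).
Local Notation pullback_normal := (pullback_normal T x y nu).

(** Up to the factor [mu], the vector [X] is [Y T], and [T] preserves the orthogonality of the
    lifted normal to [Y]. *)
Lemma sprod_lift_sigma : sprod 2 (dsigma_vec (y p) (nu p) *m T) (sigma_vec (x p)) = 0.
Proof.
apply: (mulfI mu_neq0).
by rewrite -sprodZr -sigma_yT orthT sprod_dsigma_sigma ?mulr0.
Qed.

(** [X] is null, so subtracting a multiple of it keeps the moved normal orthogonal to [X]; the
    multiple is chosen for height 0, and [orthogonal_sigma_dsigma] applies. *)
Lemma pullback_normalP : space_form_tangent (x p) (pullback_normal p) /\
  dsigma_vec (x p) (pullback_normal p) =
    dsigma_vec (y p) (nu p) *m T - normal_shift p *: sigma_vec (x p).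
Proof.
set N := _ - _.
have NE : N *m (cone_embed c n)^T = pullback_normal p.
  by rewrite mulmxBl -scalemxAl sigma_vecK.
have hN : cone_height c N = 0.
  by rewrite /N -scaleNr cone_heightD cone_heightZ cone_height_sigma mulr1 subrr.
have NS : sprod 2 N (sigma_vec (x p)) = 0.
  by rewrite /N !sprodE sprod_lift_sigma sprod_sigma_vec // mulr0 subrr.
by have [] := orthogonal_sigma_dsigma hN NS; rewrite NE => ? <-.
Qed.

Lemma sprod_pullback_normal :
  sprod (sig c) (pullback_normal p) (pullback_normal p) = sprod (sig c) (nu p) (nu p).
Proof.
rewrite -(sprod_dsigma_vec (x p)) pullback_normalP.2 !sprodE.
rewrite (sprodC _ (sigma_vec (x p)) (_ *m T)) sprod_lift_sigma sprod_sigma_vec //.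
by rewrite orthT sprod_dsigma_vec; ring.
Qed.

End ConformalPoint.

(** * First derivatives of a conformal pair *)

Section ConformalPair.
Context {R : realType} {c : curv} {n : nat} {V : normedModType R}.
Context (T : 'M[R]_n.+3) (x y : V -> 'rV[R]_(amb_dim c n)).
Hypothesis orthT : pseudo_orthogonal T.
Hypothesis xS : forall p, space_form (x p).

Local Notation mu := (conf_factor T y).

Hypothesis mu_neq0 : forall p, mu p != 0.
Hypothesis sigma_yT : forall p, sigma_vec (y p) *m T = mu p *: sigma_vec (x p).

(** Differentiate [<X, X> = 0]. *)
Lemma sprod_derive_sigma p v dx : is_derive p v x dx ->
  sprod 2 (dsigma_vec (x p) dx) (sigma_vec (x p)) = 0.
Proof.
move=> /is_derive_sigma_vec H.
have [_] := is_derive_sprod 2 H H.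
rewrite (_ : (fun z => _) = cst 0); last first.
  by apply/funext => z; exact: sprod_sigma_vec.
by rewrite derive_cst (sprodC _ (sigma_vec _)) => /esym/eqP; rewrite -mulr2n
  mulrn_eq0 /= => /eqP.
Qed.

(** Kept as a linear form in [dy], because the derivative of [normal_shift] is minus the same form,
    evaluated at [dy] of [v *m A]. *)
Definition dconf_factor p (dy : 'rV[R]_(amb_dim c n)) : R :=
  cone_height c (dsigma_vec (y p) dy *m T).

Lemma is_derive_conf_factor p v dy : is_derive p v y dy ->
  is_derive p v mu (dconf_factor p dy).
Proof.
by move=> /is_derive_sigma_vec H; apply/is_derive_cone_height/is_derive_mulmx.
Qed.

(** The Leibniz rule applied to [Y T = mu X]. *)
Lemma dsigma_yT p v dx dy : is_derive p v x dx -> is_derive p v y dy ->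
  dsigma_vec (y p) dy *m T =
    dconf_factor p dy *: sigma_vec (x p) + mu p *: dsigma_vec (x p) dx.
Proof.
move=> Hx Hy.
have [_ <-] := is_derive_mulmx T (is_derive_sigma_vec Hy).
rewrite (_ : (fun z => _) = fun z => mu z *: sigma_vec (x z)); last exact/funext.
by have [_ ->] := is_derive_scale (is_derive_conf_factor Hy) (is_derive_sigma_vec Hx).
Qed.

(** In [dY T = dmu X + mu dX] the terms in [X] drop out of all products, [X] being null and
    orthogonal to [dX]. *)
Lemma sprod_conformal p v v' dx dx' dy dy' :
  is_derive p v x dx -> is_derive p v y dy ->
  is_derive p v' x dx' -> is_derive p v' y dy' ->
  sprod (sig c) dy dy' = mu p ^+ 2 * sprod (sig c) dx dx'.
Proof.
move=> Hx Hy Hx' Hy'.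
rewrite -(sprod_dsigma_vec (y p)) -orthT (dsigma_yT Hx Hy) (dsigma_yT Hx' Hy').
rewrite !sprodE (sprodC _ (sigma_vec (x p)) (dsigma_vec _ _)).
rewrite (sprod_derive_sigma Hx) (sprod_derive_sigma Hx') sprod_sigma_vec //.
by rewrite sprod_dsigma_vec; ring.
Qed.

Section Normal.
Context (nu : V -> 'rV[R]_(amb_dim c n)).

Local Notation normal_shift := (normal_shift T y nu).
Local Notation pullback_normal := (pullback_normal T x y nu).

(** [mu dX] is [dY T - dmu X], and both terms are orthogonal to the moved normal: the first because
    [T] is orthogonal and [dy] is orthogonal to [nu], the second by [sprod_lift_sigma]. *)
Lemma sprod_derive_pullback_normal p v dx dy : space_form_tangent (y p) (nu p) ->
  is_derive p v x dx -> is_derive p v y dy ->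
  sprod (sig c) dy (nu p) = 0 -> sprod (sig c) dx (pullback_normal p) = 0.
Proof.
move=> nu_tangent Hx Hy dy_nu.
have dN : sprod 2 (dsigma_vec (x p) dx) (dsigma_vec (y p) (nu p) *m T) = 0.
  apply: (mulfI (mu_neq0 p)); rewrite mulr0 -dy_nu -(sprod_dsigma_vec (y p)).
  rewrite -[RHS]orthT (dsigma_yT Hx Hy) !sprodE (sprodC _ (sigma_vec (x p))).
  by rewrite sprod_lift_sigma // mulr0 add0r.
rewrite -(sprod_dsigma_vec (x p)) (pullback_normalP orthT _ _ _ nu_tangent).2 // !sprodE dN.
by rewrite (sprod_derive_sigma Hx) mulr0 subrr.
Qed.

(* The shape operator A of y enters through w = v *m A: d nu(v) = - dy(w). *)
Section Shape.
Context (p v w : V) (dxv dyv dxw dyw : 'rV[R]_(amb_dim c n)).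
Hypotheses (Hxv : is_derive p v x dxv) (Hyv : is_derive p v y dyv).
Hypotheses (Hxw : is_derive p w x dxw) (Hyw : is_derive p w y dyw).
Hypothesis Hnu : is_derive p v nu (- dyw).
Hypothesis dyv_nu : sprod (sig c) dyv (nu p) = 0.

Lemma is_derive_lift_normal :
  is_derive p v (fun q => dsigma_vec (y q) (nu q) *m T) (- (dsigma_vec (y p) dyw *m T)).
Proof.
apply: is_derive_eq (is_derive_mulmx T (is_derive_dsigma_vec Hyv Hnu)) _.
by rewrite dyv_nu scale0r addr0 dsigma_vecN mulNmx.
Qed.

Lemma is_derive_normal_shift : is_derive p v normal_shift (- dconf_factor p dyw).
Proof.
apply: is_derive_eq (is_derive_cone_height is_derive_lift_normal) _.
by rewrite -scaleN1r cone_heightZ mulN1r.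
Qed.

Lemma is_derive_pullback_normal :
  is_derive p v pullback_normal (- (mu p *: dxw + normal_shift p *: dxv)).
Proof.
have := is_deriveB (is_derive_mulmx (cone_embed c n)^T is_derive_lift_normal)
  (is_derive_scale is_derive_normal_shift Hxv).
move=> /is_derive_eq; apply.
(* Expanding the moved [dY(w)] gives a multiple of [x p] that cancels against the one from the
   derivative of [normal_shift]. *)
rewrite (dsigma_yT Hxw Hyw) mulNmx mulmxDl -!scalemxAl sigma_vecK dsigma_vecK.
rewrite scaleNr !opprD opprK; set a := dconf_factor _ _ *: _.
by rewrite [- a - _]addrC addrA subrK.
Qed.

End Shape.
End Normal.
End ConformalPair.

(** * Functions with zero derivative *)

Section LocallyConstant.

Lemma connected_locally_constant (T : topologicalType) (W : Type) (f : T -> W) :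
  connected [set: T] -> (forall s, \forall t \near s, f t = f s) ->
  forall s t, f s = f t.
Proof.
move=> cT loc s t; pose B := [set r | f r = f s].
have open_level (P : set W) : open (f @^-1` P).
  by rewrite openE => r Pr; apply: filterS (loc r) => q; rewrite /= => ->.
have BT : B = setT.
  apply: cT; first by exists s.
  - by exists B; [exact: (open_level [set w | w = f s])|rewrite setTI].
  - exists B; last by rewrite setTI.
    by rewrite -openC; exact: (open_level [set w | w <> f s]).
by have : B t by rewrite BT.
Qed.

Lemma is_derive_comp (R : numFieldType) (U V W : normedModType R)
    (f : U -> V) (g : V -> W) u v df dg :
  differentiable f u -> differentiable g (f u) ->
  is_derive u v f df -> is_derive (f u) df g dg -> is_derive u v (g \o f) dg.
Proof.
move=> Df Dg [_ fE] [_ gE]; have D := differentiable_comp Df Dg.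
apply: DeriveDef; first exact/diff_derivable.
by rewrite deriveE // diff_comp //= -(deriveE v Df) fE -deriveE.
Qed.

Lemma is_derive0_ball (R : realType) (V : normedModType R) (f : V -> R) u e :
  (forall z v, ball u e z -> is_derive z v f 0) ->
  forall z, ball u e z -> f z = f u.
Proof.
(* Mean value theorem on the segment from [u] to [z], which stays in the ball. The difference
   quotients of [g] along 1 and of [f] along [v] coincide, so only directional derivatives enter. *)
move=> df z uz; pose v := z - u; pose g (t : R) := f (t *: v + u).
have dg (t : R) : t \in `[0, 1]%R -> is_derive t 1 g 0.
  rewrite in_itv /= => /andP[t0 t1].
  have /(df _ v) [d dE] : ball u e (t *: v + u).
    move: uz; rewrite -ball_normE /ball_ /= => uz.
    rewrite opprD addrCA subrr addr0 normrN normrZ ger0_norm //.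
    by rewrite (le_lt_trans _ uz) // distrC ler_piMl.
  have E : (fun h : R => h^-1 *: ((g \o shift t) (h *: 1) - g t)) =
           (fun h : R => h^-1 *: ((f \o shift (t *: v + u)) (h *: v) - f (t *: v + u))).
    by apply/funext => h; rewrite /g /= addrA -scalerDl [h *: 1]mulr1.
  by apply: DeriveDef; rewrite /derivable /derive E.
have cg : {within `[0, 1], continuous g}.
  by apply: derivable_within_continuous => t /dg [].
have dg' (t : R) : t \in `]0, 1[ -> is_derive t 1 g (cst 0 t).
  by move=> /subset_itv_oo_cc; exact: dg.
have [c _] := MVT_segment ler01 dg' cg.
by rewrite mul0r /g scale1r scale0r add0r subrK => /eqP; rewrite subr_eq0 => /eqP.
Qed.

End LocallyConstant.

(** * Open sets in charts *)

Section ChartTopology.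
Context {R : realType} {n : nat} {T : topologicalType} (K : chart R n T).
Hypothesis chartK : is_chart K.

Lemma chart_map_near p (A : set 'rV[R]_n) : chart_dom K p ->
  nbhs (chart_map K p) A -> \forall q \near p, chart_dom K q /\ A (chart_map K q).
Proof.
have [oD _ _ + _] := chartK; rewrite continuous_open_subspace // => cK Kp nA.
apply: filterI; first exact: open_nbhs_nbhs.
by have /cK := mem_set Kp; apply.
Qed.

(** Inside the open image of the chart this set is the preimage of [O] under the continuous
    [chart_inv K]. *)
Lemma open_chart_image (O : set T) : open O ->
  open (chart_map K @` (chart_dom K `&` O)).
Proof.
have [oD oI KK _] := chartK; rewrite continuous_open_subspace // => cK oO.
rewrite openE => _ [p [Kp Op] <-].
have Ip : (chart_map K @` chart_dom K) (chart_map K p) by exists p.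
have nO : nbhs (chart_inv K (chart_map K p)) O by rewrite KK //; exact: open_nbhs_nbhs.
have nI : \forall z \near chart_map K p,
    (chart_map K @` chart_dom K) z /\ O (chart_inv K z).
  by apply: filterI (open_nbhs_nbhs (conj oI Ip)) (cK _ (mem_set Ip) _ nO).
by apply: filterS nI => _ [[q Kq <-]]; rewrite /= KK // => Oq; exists q.
Qed.

End ChartTopology.

(** * Pseudo-orthogonal matrices and eigenspaces *)

Section Orthogonal.
Context {R : realType}.

Lemma sprod_nondegenerate s m (X : 'rV[R]_m) : (forall Y, sprod s X Y = 0) -> X = 0.
Proof.
move=> X0; apply/rowP => i; have := X0 (delta_mx 0 i).
rewrite /sprod (bigD1 i) //= big1 => [|j ji]; last first.
  by rewrite !mxE (negPf ji) andbF mulr0 oppr0 if_same.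
rewrite addr0 !mxE !eqxx mulr1; case: ifP => // _ /eqP.
by rewrite oppr_eq0 => /eqP.
Qed.

Lemma pseudo_orthogonal_unit n (T : 'M[R]_n.+3) : pseudo_orthogonal T -> T \in unitmx.
Proof.
move=> oT; rewrite -row_free_unit; apply: inj_row_free => X XT.
by apply: (@sprod_nondegenerate 2) => Y; rewrite -oT XT sprod0l.
Qed.

Lemma pseudo_orthogonal_invmx n (T : 'M[R]_n.+3) :
  pseudo_orthogonal T -> pseudo_orthogonal (invmx T).
Proof.
by move=> oT X Y; rewrite -oT !mulmxKV // pseudo_orthogonal_unit.
Qed.

End Orthogonal.

Section EigenspaceAffine.
Context {F : fieldType} {n : nat} (A : 'M[F]_n) (mu a lam : F).
Hypothesis mu_neq0 : mu != 0.

Lemma eigenspace_affine :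
  (eigenspace (mu *: A + a%:M) (mu * lam + a) :=: eigenspace A lam)%MS.
Proof.
apply/eqmxP/andP; split; apply/eigenspaceP.
  have /eigenspaceP := submx_refl (eigenspace (mu *: A + a%:M) (mu * lam + a)).
  rewrite mulmxDr mul_mx_scalar -scalemxAr scalerDl => /addIr.
  by rewrite -scalerA => /(scalerI mu_neq0).
have /eigenspaceP E := submx_refl (eigenspace A lam).
by rewrite mulmxDr mul_mx_scalar -scalemxAr scalerDl E scalerA.
Qed.

End EigenspaceAffine.

(** * Differentials in charts *)

Section Differential.
Context {R : realType} {n : nat} {M : manifold R n} {k : nat}.
Implicit Types (K : chart R n M) (f : M -> 'rV[R]_k).

Lemma is_derive_differential K f p v :
  differentiable (f \o chart_inv K) (chart_map K p) ->
  is_derive (chart_map K p) v (f \o chart_inv K) (v *m differential K f p).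
Proof.
by move=> Df; apply: DeriveDef; [exact/diff_derivable|rewrite deriveEjacobian].
Qed.

Lemma smooth_vfun_differentiable K f O p : atlas K -> chart_dom K p -> O p ->
  smooth_vfun O f -> differentiable (f \o chart_inv K) (chart_map K p).
Proof.
by move=> aK Kp Op /(_ K aK)/smooth_onP/smooth_differentiable; apply; exists p.
Qed.

Lemma smooth_vfun_derive K f O p v : atlas K -> chart_dom K p -> O p ->
  smooth_vfun O f ->
  is_derive (chart_map K p) v (f \o chart_inv K) (v *m differential K f p).
Proof.
by move=> aK Kp Op /(smooth_vfun_differentiable aK Kp Op)/is_derive_differential.
Qed.

Lemma differential_eq K f p (B : 'M[R]_(n, k)) :
  differentiable (f \o chart_inv K) (chart_map K p) ->
  (forall v, is_derive (chart_map K p) v (f \o chart_inv K) (v *m B)) ->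
  differential K f p = B.
Proof.
move=> Df DB; apply/row_matrixP => i; rewrite !rowE.
have [_ <-] := is_derive_differential (delta_mx 0 i) Df.
by have [_ ->] := DB (delta_mx 0 i).
Qed.

Lemma smooth_vfunS (O O' : set M) f : O' `<=` O -> smooth_vfun O f -> smooth_vfun O' f.
Proof.
move=> OO sf K aK vs _ [p [Kp /OO Op] <-].
by apply: (sf K aK); exists p.
Qed.

End Differential.

(** * Conformal pairs of hypersurfaces *)

Section SmoothConformal.
Context {R : realType} {c : curv} {n : nat} {V : normedModType R}.
Context (U : set V) (oU : open U) (T : 'M[R]_n.+3).
Context (x y nu : V -> 'rV[R]_(amb_dim c n)).
Hypotheses (sx : smooth U x) (sy : smooth U y) (snu : smooth U nu).

Lemma smooth_conf_factor : smooth U (conf_factor T y).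
Proof. by apply: smooth_cone_height => //; apply/smooth_mulmx/smooth_sigma_vec. Qed.

Lemma smooth_normal_shift : smooth U (normal_shift T y nu).
Proof. by apply: smooth_cone_height => //; apply/smooth_mulmx/smooth_dsigma_vec. Qed.

Lemma smooth_pullback_normal : smooth U (pullback_normal T x y nu).
Proof.
pose a p := -1 * normal_shift T y nu p.
have sa : smooth U a by apply: smoothM => //; [exact: smooth_cst|exact: smooth_normal_shift].
have := smoothD oU (smooth_mulmx oU (cone_embed c n)^T (smooth_mulmx oU T
  (smooth_dsigma_vec oU sy snu))) (smoothZ oU sa sx).
by apply: smooth_eq => // p _; rewrite /a mulN1r scaleNr.
Qed.

End SmoothConformal.

Section ConformalHypersurface.
Context {R : realType} {c : curv} {n : nat} {M : manifold R n}.
Context (T : 'M[R]_n.+3) (x y : M -> 'rV[R]_(amb_dim c n)).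
Hypothesis orthT : pseudo_orthogonal T.
Hypothesis xS : forall p, space_form (x p).
Hypothesis mu_neq0 : forall p, conf_factor T y p != 0.
Hypothesis sigma_yT :
  forall p, sigma_vec (y p) *m T = conf_factor T y p *: sigma_vec (x p).
Hypothesis smooth_x : smooth_vfun setT x.
Hypothesis smooth_y : smooth_vfun setT y.

Section InChart.
Context (K : chart R n M) (aK : atlas K) (p : M) (Kp : chart_dom K p).
Local Notation q := (chart_map K p).

Lemma chart_mapK : chart_inv K q = p.
Proof. by have [_ _ KK _ _] := atlas_chart aK; exact: KK. Qed.

Lemma sprod_differential_conformal v w :
  sprod (sig c) (v *m differential K y p) (w *m differential K y p) =
  conf_factor T y p ^+ 2 *
    sprod (sig c) (v *m differential K x p) (w *m differential K x p).
Proof.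
have Dx u := smooth_vfun_derive u aK Kp I smooth_x.
have Dy u := smooth_vfun_derive u aK Kp I smooth_y.
(* [chart_inv K] takes values in [M] everywhere, so the pointwise hypotheses of the pair hold on all
   of R^n and not only on the image of the chart. *)
have := @sprod_conformal R c n _ T (x \o chart_inv K) (y \o chart_inv K) orthT
  (fun u => xS (chart_inv K u)) (fun u => sigma_yT (chart_inv K u))
  q v w _ _ _ _ (Dx v) (Dy v) (Dx w) (Dy w).
by rewrite /conf_factor /= chart_mapK.
Qed.

End InChart.

Section Normal.
Context (O : set M) (nu : M -> 'rV[R]_(amb_dim c n)).
Hypotheses (oO : open O) (nuP : unit_normal y O nu).

Lemma smooth_vfun_pullback_normal : smooth_vfun O (pullback_normal T x y nu).
Proof.
have [snu _ _ _] := nuP; move=> K aK; apply/smooth_onP.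
apply: smooth_pullback_normal; first exact/open_chart_image/oO/atlas_chart.
- by apply/smooth_onP; exact: (smooth_vfunS _ smooth_x aK).
- by apply/smooth_onP; exact: (smooth_vfunS _ smooth_y aK).
- exact/smooth_onP/snu.
Qed.

Lemma unit_normal_pullback : unit_normal x O (pullback_normal T x y nu).
Proof.
have [snu tnu nu1 nuN] := nuP; split; first exact: smooth_vfun_pullback_normal.
- by move=> p Op; case: (@pullback_normalP _ _ _ _ T x y nu p); auto.
- by move=> p Op; rewrite sprod_pullback_normal; auto.
move=> K p v aK Kp Op.
have Dx := smooth_vfun_derive v aK Kp I smooth_x.
have Dy := smooth_vfun_derive v aK Kp I smooth_y.
have := @sprod_derive_pullback_normal R c n _ T (x \o chart_inv K) (y \o chart_inv K)
  orthT (fun u => xS (chart_inv K u)) (fun u => mu_neq0 (chart_inv K u))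
  (fun u => sigma_yT (chart_inv K u)) (nu \o chart_inv K) _ v _ _ _ Dx Dy.
rewrite /pullback_normal /normal_shift /= (chart_mapK aK Kp); apply.
  exact: tnu.
exact: nuN.
Qed.

Section Shape.
Context (K : chart R n M) (p : M) (A : 'M[R]_n).
Hypotheses (aK : atlas K) (Kp : chart_dom K p) (Op : O p).
Hypothesis shapeA : shape_operator y nu K p A.
Local Notation q := (chart_map K p).

Lemma derive_normal_shape v :
  is_derive q v (nu \o chart_inv K) (- (v *m A *m differential K y p)).
Proof.
have [snu _ _ _] := nuP; apply: is_derive_eq (smooth_vfun_derive v aK Kp Op snu) _.
by rewrite shapeA mulmxN mulmxA.
Qed.

Lemma derive_tangent_normal v :
  sprod (sig c) (v *m differential K y p) ((nu \o chart_inv K) q) = 0.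
Proof. by have [_ _ _ nuN] := nuP; rewrite /= (chart_mapK aK Kp) nuN. Qed.

Lemma is_derive_normal_shift_chart v :
  is_derive q v (normal_shift T y nu \o chart_inv K)
    (- dconf_factor T (y \o chart_inv K) q (v *m A *m differential K y p)).
Proof.
exact: is_derive_normal_shift (smooth_vfun_derive v aK Kp I smooth_y)
  (derive_normal_shape v) (derive_tangent_normal v).
Qed.

Lemma is_derive_conf_factor_chart v :
  is_derive q v (conf_factor T y \o chart_inv K)
    (dconf_factor T (y \o chart_inv K) q (v *m differential K y p)).
Proof. exact: is_derive_conf_factor (smooth_vfun_derive v aK Kp I smooth_y). Qed.

Lemma shape_operator_pullback :
  shape_operator x (pullback_normal T x y nu) K p
    (conf_factor T y p *: A + (normal_shift T y nu p)%:M).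
Proof.
apply: differential_eq => [|v].
  exact: smooth_vfun_differentiable aK Kp Op smooth_vfun_pullback_normal.
have Dx w := smooth_vfun_derive w aK Kp I smooth_x.
have Dy w := smooth_vfun_derive w aK Kp I smooth_y.
have := @is_derive_pullback_normal R c n _ T (x \o chart_inv K) (y \o chart_inv K)
  (fun u => sigma_yT (chart_inv K u)) (nu \o chart_inv K) q v (v *m A) _ _ _ _
  (Dx v) (Dy v) (Dx (v *m A)) (Dy (v *m A)) (derive_normal_shape v)
  (derive_tangent_normal v).
move=> /is_derive_eq; apply.
rewrite /conf_factor /normal_shift /= (chart_mapK aK Kp).
by rewrite mulmxN mulmxDl mulmxDr mul_scalar_mx -!scalemxAl -!scalemxAr mulmxA.
Qed.

End Shape.

Context (k : nat) (S : manifold R k) (j : S -> M) (lam : S -> R).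
Hypothesis surf : curvature_surface y O nu j lam.

Lemma curvature_surface_pullback :
  curvature_surface x O (pullback_normal T x y nu) j
    (fun s => conf_factor T y (j s) * lam s + normal_shift T y nu (j s)).
Proof.
have [cS inj_j imm_j Oj sh] := surf; split=> // s I0 K aI aK Is Kj.
have [A [shA eA dA]] := sh s I0 K aI aK Is Kj.
exists (conf_factor T y (j s) *: A + (normal_shift T y nu (j s))%:M).
have E := eigenspace_affine A (normal_shift T y nu (j s)) (lam s) (mu_neq0 (j s)).
split; first exact: shape_operator_pullback (Oj s) shA.
- by rewrite /eigenvalue -mxrank_eq0 E mxrank_eq0.
- exact: eqmx_trans dA (eqmx_sym E).
Qed.

End Normal.
End ConformalHypersurface.

(** * Constancy of the principal curvature *)

Lemma is_derive_quotient (R : realType) (V : normedModType R) (f g : V -> R) df dg u v :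
  g u != 0 -> is_derive u v f df -> is_derive u v g dg ->
  is_derive u v (fun z => f z / g z) (df / g u - f u * dg / g u ^+ 2).
Proof.
move=> gu Df [Dg dgE].
have DV : is_derive u v (fun z => (g z)^-1) (- g u ^- 2 *: dg).
  by apply: DeriveDef; [exact: derivableV|rewrite deriveV // dgE].
apply: is_derive_eq (is_derive_mul Df DV) _.
by rewrite /GRing.scale /=; field.
Qed.

Section PrincipalCurvature.
Context {R : realType} {c : curv} {n : nat} {M : manifold R n}.
Context (T : 'M[R]_n.+3) (y : M -> 'rV[R]_(amb_dim c n)).
Hypothesis mu_neq0 : forall p, conf_factor T y p != 0.
Hypothesis smooth_y : smooth_vfun setT y.
Context (O : set M) (nu : M -> 'rV[R]_(amb_dim c n)).
Hypotheses (oO : open O) (nuP : unit_normal y O nu).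
Context (k : nat) (S : manifold R k) (j : S -> M) (lam : S -> R).
Hypothesis surf : curvature_surface y O nu j lam.

Lemma differentiable_conf_factor K p : atlas K -> chart_dom K p ->
  differentiable (conf_factor T y \o chart_inv K) (chart_map K p).
Proof.
move=> aK Kp.
apply: (@smooth_differentiable _ _ _ (chart_map K @` (chart_dom K `&` setT))).
  apply: smooth_conf_factor; last exact/smooth_onP/smooth_y.
  exact/open_chart_image/openT/atlas_chart.
by exists p.
Qed.

Lemma differentiable_normal_shift K p : atlas K -> chart_dom K p -> O p ->
  differentiable (normal_shift T y nu \o chart_inv K) (chart_map K p).
Proof.
have [snu _ _ _] := nuP; move=> aK Kp Op.
apply: (@smooth_differentiable _ _ _ (chart_map K @` (chart_dom K `&` O))).
  apply: smooth_normal_shift; first exact/open_chart_image/oO/atlas_chart.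
  - by apply/smooth_onP; exact: (smooth_vfunS _ smooth_y aK).
  - exact/smooth_onP/snu.
by exists p.
Qed.

(* Along a curvature surface, d a = - d mu (A w) = - lam * d mu (w) while      *)
(* a = C - mu * lam; hence d lam = 0.                                          *)
Lemma principal_curvature_derive C (I : chart R k S) K s v :
  (forall t, conf_factor T y (j t) * lam t + normal_shift T y nu (j t) = C) ->
  atlas I -> atlas K -> chart_dom I s -> chart_dom K (j s) ->
  is_derive (chart_map I s) v (lam \o chart_inv I) 0.
Proof.
move=> lamC aI aK Is Kjs; have [_ _ [[cj sj] _] Oj sh] := surf.
have [A [shA _ /eqmxP/andP[/eigenspaceP dA _]]] := sh s I K aI aK Is Kjs.
have oW : open (chart_map I @` (chart_dom I `&` j @^-1` chart_dom K)).
  apply: open_chart_image; first exact: atlas_chart.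
  by apply: open_comp => [? _|]; [exact: cj|have [] := atlas_chart aK].
have Ws : (chart_map I @` (chart_dom I `&` j @^-1` chart_dom K)) (chart_map I s).
  by exists s.
pose h := chart_map K \o j \o chart_inv I.
have hs : h (chart_map I s) = chart_map K (j s) by rewrite /h /= chart_mapK.
have Dh : differentiable h (chart_map I s) by exact: sj [::] _ Ws.
(* The image of [v] in the tangent space of the surface, hence a principal vector. *)
pose w := v *m differential I (chart_map K \o j) s.
have wA : w *m A = lam s *: w by rewrite /w -mulmxA dA -scalemxAr.
have dh : is_derive (chart_map I s) v h w by exact: is_derive_differential Dh.
(* The chain rule wants its data at [h (chart_map I s)], while they are known at
   [chart_map K (j s)]; [eq_rect_r] transports them along [hs]. *)
have Dmu := is_derive_comp Dh
  (eq_rect_r (fun q => differentiable _ q) (differentiable_conf_factor aK Kjs) hs) dh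
  (eq_rect_r (fun q => is_derive q _ _ _) (is_derive_conf_factor_chart T smooth_y aK Kjs w) hs).
have Da := is_derive_comp Dh
  (eq_rect_r (fun q => differentiable _ q) (differentiable_normal_shift aK Kjs (Oj s)) hs) dh
  (eq_rect_r (fun q => is_derive q _ _ _)
    (is_derive_normal_shift_chart T smooth_y nuP aK Kjs (Oj s) shA w) hs).
set mu := _ \o h in Dmu; set a := _ \o h in Da.
have mus : mu (chart_map I s) = conf_factor T y (j s) by rewrite /mu /= hs chart_mapK.
have as_ : a (chart_map I s) = normal_shift T y nu (j s) by rewrite /a /= hs chart_mapK.
(* Near the point [lam] equals a quotient of differentiable functions, and this is where its
   derivative comes from. *)
have lamE : \forall z \near chart_map I s, (C - a z) / mu z = (lam \o chart_inv I) z.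
  apply: filterS (open_nbhs_nbhs (conj oW Ws)) => _ [t [It Kjt] <-].
  rewrite /a /mu /h /= !chart_mapK // -(lamC t) addrK mulrC mulKf //.
apply: near_eq_is_derive lamE _.
have := is_derive_quotient _ (is_deriveB (is_derive_cst C _ _) Da) Dmu.
rewrite mus => /(_ (mu_neq0 _))/is_derive_eq; apply.
rewrite wA -scalemxAl /dconf_factor dsigma_vecZ -scalemxAl cone_heightZ.
set d := cone_height _ _.
have -> : (cst C - a) (chart_map I s) = conf_factor T y (j s) * lam s.
  by rewrite !fctE as_ -(lamC s) addrK.
by have := mu_neq0 (j s) => ?; field.
Qed.

Lemma principal_curvature_const C :
  (forall t, conf_factor T y (j t) * lam t + normal_shift T y nu (j t) = C) ->
  forall s t, lam s = lam t.
Proof.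
move=> lamC; have [cS _ [[cj _] _] _ _] := surf.
apply: connected_locally_constant cS _ => s.
have [I aI Is] := atlas_cover s; have [K aK Kjs] := atlas_cover (j s).
have chI := atlas_chart aI.
have oD : open (j @^-1` chart_dom K).
  by apply: open_comp => [? _|]; [exact: cj|have [] := atlas_chart aK].
(* A ball in the chart [I] on which [j] stays within the single chart [K]. *)
have : nbhs (chart_map I s) (chart_map I @` (chart_dom I `&` j @^-1` chart_dom K)).
  by apply: open_nbhs_nbhs; split; [exact: open_chart_image|exists s].
rewrite -nbhs_ballE => -[e /= e0 eW].
have := chart_map_near chI Is (nbhsx_ballx _ _ e0).
apply: filterS => t [It et].
have [_ _ IK _ _] := chI; rewrite -[in LHS](IK t) // -[in RHS](IK s) //.
apply: (@is_derive0_ball _ _ (lam \o chart_inv I) _ e) et => z v /eW[r [Ir Kjr] <-].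
exact: principal_curvature_derive lamC aI aK Ir Kjr.
Qed.

End PrincipalCurvature.

(** * Image under a conformal transformation *)

Section ConformalImage.
Context {R : realType} {c : curv} {n : nat}.

(** Equal lines have proportional representatives, [sigma_vec w = a *: (sigma_vec u *m T)], and the
    normalization of lifts to height 1 determines [a] from either side: as a height after applying
    [invmx T], and as the inverse of a height before it. The second form depends on [u] alone, which
    makes it usable for smoothness. *)
Lemma sigma_act_conf_factor (T : 'M[R]_n.+3) (u w : 'rV[R]_(amb_dim c n)) :
  T \in unitmx -> sigma w = proj_act T (sigma u) ->
  [/\ sigma_vec w *m invmx T = cone_height c (sigma_vec w *m invmx T) *: sigma_vec u,
      cone_height c (sigma_vec w *m invmx T) != 0 &
      sigma_vec w = (cone_height c (sigma_vec u *m T))^-1 *: (sigma_vec u *m T)].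
Proof.
move=> uT E.
have : (sigma_vec w <= sigma_vec u *m T)%MS.
  by rewrite -(genmxE (sigma_vec w)) -/(proj_point _) -/(sigma w) E genmxE
    (eqmxMr _ (genmxE _)).
move=> /sub_rVP[a wE].
have a1 : a * cone_height c (sigma_vec u *m T) = 1.
  by rewrite -cone_heightZ -wE cone_height_sigma.
have a0 : a != 0 by apply: contra_eq_neq a1 => ->; rewrite mul0r eq_sym oner_neq0.
have wT : sigma_vec w *m invmx T = a *: sigma_vec u.
  by rewrite wE -scalemxAl mulmxK.
have -> : cone_height c (sigma_vec w *m invmx T) = a.
  by rewrite wT cone_heightZ cone_height_sigma mulr1.
split=> //; rewrite [LHS]wE; congr (_ *: _).
by rewrite -(mulr1_eq a1) invrK.
Qed.

End ConformalImage.

Theorem theorem3p1 (R : realType) (c : curv) (n : nat) (M : manifold R n)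
    (x : M -> 'rV[R]_(amb_dim c n))
    (D : set 'rV[R]_(amb_dim c n))
    (phi : 'rV[R]_(amb_dim c n) -> 'rV[R]_(amb_dim c n))
    (hx : spacelike_dupin_hypersurface x)
    (hphi : conformal_transformation D phi)
    (hD : forall p : M, D (x p)) :
  spacelike_dupin_hypersurface (phi \o x).
Proof.
have [[xS sx _ xpos] dupx] := hx; have [_ _ [T oT phiT]] := hphi.
have uT := pseudo_orthogonal_unit oT; have oV := pseudo_orthogonal_invmx oT.
pose y := phi \o x.
have yS p : space_form (y p) by have [] := phiT _ (hD p).
have yT p := sigma_act_conf_factor uT (phiT _ (hD p)).2.
have mu0 p : conf_factor (invmx T) y p != 0 by have [] := yT p.
have sigma_yT p : sigma_vec (y p) *m invmx T =
    conf_factor (invmx T) y p *: sigma_vec (x p) by have [] := yT p.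
(* Smoothness of [phi] is not part of its definition; it results from the explicit formula for the
   lift of [y] as [X T] divided by its height, from which [sigma_vecK] reads off [y]. *)
have sy : smooth_vfun setT y.
  move=> K aK; have /smooth_onP sxK := sx K aK; apply/smooth_onP.
  have oU := open_chart_image (atlas_chart aK) (@openT M).
  have sxT := smooth_mulmx oU T (smooth_sigma_vec oU sxK).
  have h0 u : cone_height c (sigma_vec ((x \o chart_inv K) u) *m T) != 0.
    have [_ _ E] := yT (chart_inv K u).
    have := cone_height_sigma (y (chart_inv K u)); rewrite E cone_heightZ => /eqP.
    by apply: contraTneq => /= ->; rewrite mulr0 eq_sym oner_eq0.
  have := smooth_mulmx oU (cone_embed c n)^T
    (smoothZ oU (smoothV oU (fun u _ => h0 u) (smooth_cone_height oU sxT)) sxT).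
  apply: smooth_eq => // u _; have [_ _ E] := yT (chart_inv K u).
  by rewrite /= -E sigma_vecK.
have ypos K p (v : 'rV[R]_n) : atlas K -> chart_dom K p -> v != 0 ->
    0 < sprod (sig c) (v *m differential K y p) (v *m differential K y p).
  move=> aK Kp v0; rewrite (sprod_differential_conformal oV xS sigma_yT sx sy aK Kp).
  by rewrite mulr_gt0 ?xpos // exprn_even_gt0 //= mu0.
split; first split=> // K p aK Kp.
  (* Positivity already forces injectivity: a nonzero kernel vector would have square 0. *)
  apply: inj_row_free => v v0; apply/eqP; apply: contraT => /(ypos K p v aK Kp).
  by rewrite v0 sprod0l ltxx.
move=> O nu oO nuP k S j lam surf.
have surfx := curvature_surface_pullback mu0 sigma_yT sx sy oO nuP surf.
have lamC := dupx _ _ oO (unit_normal_pullback oV xS mu0 sigma_yT sx sy oO nuP)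
  _ _ _ _ surfx.
(* The constant [C] is the value of [mu lam + a] at [s], so the points are introduced first. *)
move=> s t; apply: (principal_curvature_const mu0 sy oO nuP surf _ s t).
by move=> r; exact: (lamC r s).
Qed.
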